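(* For $\lambda\mu$-terms $M,N$: if $M=_{\beta\mu}N$, then $M\equiv_{wA}N$.
   Context: $\lambda\mu$-terms: $M ::= x\mid\lambda x.M\mid MN\mid\mu\alpha.[\beta]M$. $M[N/x]$ substitution, $M[\beta/\gamma]$ name renaming, $M[N\cdot\gamma/\alpha]$ replaces recursively every subterm $[\alpha]M'$ by $[\gamma](M'[N\cdot\gamma/\alpha])N$. $\to_{\beta\mu}$: closure under all contexts of $(\lambda x.M)N\to M[N/x]$; $(\mu\alpha.[\beta]M)N\to\mu\gamma.(([\beta]M)[N\cdot\gamma/\alpha])$ ($\gamma$ fresh); $\mu\delta.[\beta]\mu\gamma.[\alpha]M\to\mu\delta.(([\alpha]M)[\beta/\gamma])$; $\mu\alpha.[\alpha]M\to M$ ($\alpha\notin\mathrm{fn}(M)$); $=_{\beta\mu}$ is the congruence it generates. Weak approximants: $A::=\bot\mid\lambda x.A\mid xA_1\cdots A_n\ (n\ge0)\mid\mu\alpha.[\beta]A$ ($\alpha\ne\beta$ or $\alpha$ occurs in $A$, $A$ not of form $\mu\gamma.[\delta]A'$, $A\neq\bot$). $\sqsubseteq$: smallest preorder that is the compatible extension of $\bot\sqsubseteq M$. $\mathcal A(M)=\{A\mid\exists N\,(M\to^*_{\beta\mu}N\wedge A\sqsubseteq N)\}$; $M\equiv_{wA}N$ iff $\mathcal A(M)=\mathcal A(N)$. *)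

(* Defs.v *)
From Stdlib Require Import Arith List Relations.

(** Terms are taken up to alpha-conversion, with de Bruijn indices for variables
    and, separately, for names. In [Mu b M], which stands for mu alpha.[beta]M,
    both the index [b] of beta and the names of [M] are in the scope of alpha, so
    that [b = 0] means beta = alpha and [b = S k] refers to the k-th name of the
    outer scope. [Lam] shifts only variables, [Mu] only names. *)
Inductive term : Type :=
| Var (x : nat)
| Lam (M : term)
| App (M N : term)
| Mu (b : nat) (M : term).

Definition up_ren (r : nat -> nat) (n : nat) : nat :=
  match n with 0 => 0 | S m => S (r m) end.

(** [r] acts on free variables, [s] on free names. *)
Fixpoint ren (r s : nat -> nat) (M : term) : term :=
  match M with
  | Var x => Var (r x)
  | Lam M => Lam (ren (up_ren r) s M)
  | App M N => App (ren r s M) (ren r s N)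
  | Mu b M => Mu (up_ren s b) (ren r (up_ren s) M)
  end.

Definition lift_var (M : term) : term := ren S (fun a => a) M.
Definition lift_name (M : term) : term := ren (fun x => x) S M.

Definition up_sub (s : nat -> term) (n : nat) : term :=
  match n with 0 => Var 0 | S m => lift_var (s m) end.

Fixpoint subst (s : nat -> term) (M : term) : term :=
  match M with
  | Var x => s x
  | Lam M => Lam (subst (up_sub s) M)
  | App M N => App (subst s M) (subst s N)
  | Mu b M => Mu b (subst (fun x => lift_name (s x)) M)
  end.

(** M[N/x], for x the variable of index 0, whose binder is removed. *)
Definition subst0 (N M : term) : term :=
  subst (fun x => match x with 0 => N | S y => Var y end) M.

(** ([alpha]M)[beta/gamma], for gamma the name of index 0, whose binder is
    removed, is made of the following two. *)
Definition name_inst (b a : nat) : nat :=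
  match a with 0 => b | S c => c end.
Definition name_subst0 (b : nat) (M : term) : term :=
  ren (fun x => x) (name_inst b) M.

Definition push_arg (a : nat) (N : term) (b : nat) (P : term) : term :=
  if b =? a then App P N else P.

(** M[N.gamma/alpha], for alpha of index [a]. As alpha does not occur in the
    result, the fresh name gamma is given the index of alpha; so
    ([beta]M)[N.gamma/alpha] has the same name index [b] as [beta]M, and its body
    is [push_arg a N b (ssubst a N M)]. It is assumed that alpha is not free
    in [N]. *)
Fixpoint ssubst (a : nat) (N M : term) : term :=
  match M with
  | Var x => Var x
  | Lam M => Lam (ssubst a (lift_var N) M)
  | App P Q => App (ssubst a N P) (ssubst a N Q)
  | Mu b M =>
      Mu b (push_arg (S a) (lift_name N) b (ssubst (S a) (lift_name N) M))
  end.

Fixpoint fn (a : nat) (M : term) : Prop :=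
  match M with
  | Var _ => False
  | Lam M => fn a M
  | App M N => fn a M \/ fn a N
  | Mu b M => b = S a \/ fn (S a) M
  end.

Inductive step : term -> term -> Prop :=
| step_beta M N : step (App (Lam M) N) (subst0 N M)
| step_mu b M N :
    step (App (Mu b M) N)
         (Mu b (push_arg 0 (lift_name N) b (ssubst 0 (lift_name N) M)))
| step_rename b a M :
    step (Mu b (Mu a M)) (Mu (name_inst b a) (name_subst0 b M))
(* [pred] removes the unused name of index 0 *)
| step_erase M : ~ fn 0 M -> step (Mu 0 M) (ren (fun x => x) pred M)
| step_lam M M' : step M M' -> step (Lam M) (Lam M')
| step_appl M M' N : step M M' -> step (App M N) (App M' N)
| step_appr M N N' : step N N' -> step (App M N) (App M N')
| step_Mu b M M' : step M M' -> step (Mu b M) (Mu b M').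

Definition steps : term -> term -> Prop := clos_refl_trans term step.

Inductive eq_betamu : term -> term -> Prop :=
| eqbm_step M N : step M N -> eq_betamu M N
| eqbm_refl M : eq_betamu M M
| eqbm_sym M N : eq_betamu M N -> eq_betamu N M
| eqbm_trans M N P : eq_betamu M N -> eq_betamu N P -> eq_betamu M P
| eqbm_lam M M' : eq_betamu M M' -> eq_betamu (Lam M) (Lam M')
| eqbm_app M M' N N' :
    eq_betamu M M' -> eq_betamu N N' -> eq_betamu (App M N) (App M' N')
| eqbm_mu b M M' : eq_betamu M M' -> eq_betamu (Mu b M) (Mu b M').

(** Terms with bottom, under the same indexing conventions. *)
Inductive pterm : Type :=
| PBot
| PVar (x : nat)
| PLam (A : pterm)
| PApp (A B : pterm)
| PMu (b : nat) (A : pterm).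

Fixpoint embed (M : term) : pterm :=
  match M with
  | Var x => PVar x
  | Lam M => PLam (embed M)
  | App M N => PApp (embed M) (embed N)
  | Mu b M => PMu b (embed M)
  end.

Fixpoint pfn (a : nat) (A : pterm) : Prop :=
  match A with
  | PBot | PVar _ => False
  | PLam A => pfn a A
  | PApp A B => pfn a A \/ pfn a B
  | PMu b A => b = S a \/ pfn (S a) A
  end.

Inductive weak_approximant : pterm -> Prop :=
| wa_bot : weak_approximant PBot
| wa_lam A : weak_approximant A -> weak_approximant (PLam A)
| wa_app x (As : list pterm) :
    (forall A, In A As -> weak_approximant A) ->
    weak_approximant (fold_left PApp As (PVar x))
| wa_mu b A :
    weak_approximant A ->
    b <> 0 \/ pfn 0 A ->
    (forall d A', A <> PMu d A') ->
    A <> PBot ->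
    weak_approximant (PMu b A).

Inductive ple : pterm -> pterm -> Prop :=
| ple_bot A : ple PBot A
| ple_refl A : ple A A
| ple_trans A B C : ple A B -> ple B C -> ple A C
| ple_lam A A' : ple A A' -> ple (PLam A) (PLam A')
| ple_app A A' B B' : ple A A' -> ple B B' -> ple (PApp A B) (PApp A' B')
| ple_mu b A A' : ple A A' -> ple (PMu b A) (PMu b A').

Definition approximants (M : term) (A : pterm) : Prop :=
  weak_approximant A /\ exists N, steps M N /\ ple A (embed N).

Definition equiv_wA (M N : term) : Prop :=
  forall A, approximants M A <-> approximants N A.

(* Main.v *)
From Stdlib Require Import Arith List Relations.
Require Import Defs.
Import ListNotations.

(** Approximants persist under reduction, since a redex of a term above a weak
    approximant [A] lies above a subterm [bot] of [A]; so it is enough to prove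
    Church-Rosser. Confluence follows from the Z property: there is a map [bul]
    with [N ->> bul M ->> bul N] whenever [M -> N]. It rebuilds a term bottom-up,
    contracting at each application ([apply]) and each abstraction of a name
    ([mu]) the redex formed with the already computed subterms. Since only [->>]
    is asked for, the redexes that structural substitution creates inside nested
    name abstractions, which defeat the usual parallel reductions, do no harm. *)

(** * Simultaneous substitutions and their composition *)

Definition apps (M : term) (l : list term) : term := fold_left App l M.

(** One simultaneous substitution covers [ren], [subst] and [ssubst]: it maps the
    variable [x] to [gvar x] and each [[a]M] to [[gname a](M N1 ... Nk)], where
    [gargs a] is [N1, ..., Nk]. Every commutation of substitutions is then an
    instance of [gs_gs] or [gmu_gmu], followed by a pointwise comparison. *)
Record gsub : Type := GSub {
  gvar : nat -> term;
  gname : nat -> nat;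
  gargs : nat -> list term }.

Definition up_lam (s : gsub) : gsub :=
  GSub (up_sub (gvar s)) (gname s) (fun a => map lift_var (gargs s a)).

Definition up_args (l : nat -> list term) (a : nat) : list term :=
  match a with 0 => [] | S c => map lift_name (l c) end.

Definition up_mu (s : gsub) : gsub :=
  GSub (fun x => lift_name (gvar s x)) (up_ren (gname s)) (up_args (gargs s)).

Fixpoint gs (s : gsub) (M : term) : term :=
  match M with
  | Var x => gvar s x
  | Lam M => Lam (gs (up_lam s) M)
  | App M N => App (gs s M) (gs s N)
  | Mu b M =>
      Mu (gname (up_mu s) b) (apps (gs (up_mu s) M) (gargs (up_mu s) b))
  end.

(** Here [s] also acts on the bound name, unlike in [gs s (Mu b M)], which is [gmu (up_mu s) b M].
    The reducts of the structural and of the renaming rule have this form. *)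
Definition gmu (s : gsub) (b : nat) (M : term) : term :=
  Mu (gname s b) (apps (gs s M) (gargs s b)).

Definition gren (r q : nat -> nat) : gsub :=
  GSub (fun x => Var (r x)) q (fun _ => []).

(** After [s], the image of [[a]M] already carries [gargs s a]; the arguments that [t] attaches to
    the new name come after them. *)
Definition gcomp (t s : gsub) : gsub :=
  GSub (fun x => gs t (gvar s x)) (fun a => gname t (gname s a))
    (fun a => map (gs t) (gargs s a) ++ gargs t (gname s a)).

Lemma gs_apps (s : gsub) (l : list term) (M : term) :
  gs s (apps M l) = apps (gs s M) (map (gs s) l).
Proof. revert M; induction l; intros M; simpl; auto. Qed.

Lemma ren_apps r q (l : list term) (M : term) :
  ren r q (apps M l) = apps (ren r q M) (map (ren r q) l).
Proof. revert M; induction l; intros M; simpl; auto. Qed.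

Lemma apps_app (M : term) (l k : list term) :
  apps M (l ++ k) = apps (apps M l) k.
Proof. apply fold_left_app. Qed.

Lemma gs_ext_fn (M : term) (s t : gsub) :
  (forall x, gvar s x = gvar t x) ->
  (forall a, fn a M -> gname s a = gname t a /\ gargs s a = gargs t a) ->
  gs s M = gs t M.
Proof.
  revert s t; induction M as [x|M IH|M IHM N IHN|b M IH]; intros s t Hv Hn; simpl.
  - apply Hv.
  - f_equal. apply IH; simpl.
    + intros [|x]; simpl; [easy|]. now rewrite Hv.
    + intros a Ha. destruct (Hn a Ha) as [-> ->]; auto.
  - f_equal; [apply IHM|apply IHN]; auto; intros a Ha; apply Hn; simpl; auto.
  - assert (E : forall a, b = a \/ fn a M ->
      up_ren (gname s) a = up_ren (gname t) a /\
      up_args (gargs s) a = up_args (gargs t) a).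
    { intros [|a] Ha; simpl; [easy|].
      destruct (Hn a) as [-> ->]; auto. }
    destruct (E b) as [-> ->]; auto.
    f_equal. f_equal. apply IH; simpl.
    + intros x. now rewrite Hv.
    + intros a Ha. apply E; auto.
Qed.

Lemma gs_ext (M : term) (s t : gsub) :
  (forall x, gvar s x = gvar t x) ->
  (forall a, gname s a = gname t a) ->
  (forall a, gargs s a = gargs t a) ->
  gs s M = gs t M.
Proof. intros; apply gs_ext_fn; auto. Qed.

Lemma gmu_ext (b : nat) (M : term) (s t : gsub) :
  (forall x, gvar s x = gvar t x) ->
  (forall a, gname s a = gname t a) ->
  (forall a, gargs s a = gargs t a) ->
  gmu s b M = gmu t b M.
Proof.
  intros Hv Hn Ha. unfold gmu. now rewrite Hn, Ha, (gs_ext M s t).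
Qed.

Lemma ren_gs (M : term) (r q : nat -> nat) : ren r q M = gs (gren r q) M.
Proof.
  revert r q; induction M as [x|M IH|M IHM N IHN|b M IH]; intros r q; simpl;
    f_equal; auto.
  - rewrite IH. apply gs_ext; simpl; auto. now intros [|x].
  - rewrite IH. replace (up_args (fun _ => []) b) with (@nil term)
      by now destruct b. simpl.
    apply gs_ext; simpl; auto. now intros [|a].
Qed.

Lemma gs_id (M : term) (s : gsub) :
  (forall x, gvar s x = Var x) ->
  (forall a, fn a M -> gname s a = a /\ gargs s a = []) ->
  gs s M = M.
Proof.
  revert s; induction M as [x|M IH|M IHM N IHN|b M IH]; intros s Hv Hn; simpl.
  - apply Hv.
  - f_equal. apply IH; simpl.
    + intros [|x]; simpl; [easy|]. now rewrite Hv.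
    + intros a Ha. destruct (Hn a Ha) as [-> ->]; auto.
  - f_equal; [apply IHM|apply IHN]; auto; intros a Ha; apply Hn; simpl; auto.
  - assert (E : forall a, b = a \/ fn a M ->
      up_ren (gname s) a = a /\ up_args (gargs s) a = []).
    { intros [|a] Ha; simpl; [easy|].
      destruct (Hn a) as [-> ->]; auto. }
    destruct (E b) as [-> ->]; auto.
    f_equal. simpl. apply IH; simpl.
    + intros x. now rewrite Hv.
    + intros a Ha. apply E; auto.
Qed.

(** Composition with a renaming, here and on the other side in [ren_comp_gs], precedes [gs_gs],
    which needs both to exchange a substitution with the lifting under binders. *)
Lemma gs_ren (M : term) (t : gsub) (r q : nat -> nat) :
  gs t (ren r q M) =
  gs (GSub (fun x => gvar t (r x)) (fun a => gname t (q a))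
        (fun a => gargs t (q a))) M.
Proof.
  revert t r q; induction M as [x|M IH|M IHM N IHN|b M IH]; intros t r q; simpl.
  - easy.
  - f_equal. rewrite IH. apply gs_ext; simpl; auto. now intros [|x].
  - f_equal; auto.
  - rewrite IH. f_equal; [now destruct b|].
    f_equal; [|now destruct b].
    apply gs_ext; simpl; auto; now intros [|a].
Qed.

Lemma ren_ren (M : term) (r q r' q' : nat -> nat) :
  ren r q (ren r' q' M) = ren (fun x => r (r' x)) (fun a => q (q' a)) M.
Proof. rewrite ren_gs, gs_ren. symmetry; apply ren_gs. Qed.

Lemma ren_comp_gs (M : term) (s : gsub) (r q : nat -> nat) :
  ren r q (gs s M) =
  gs (GSub (fun x => ren r q (gvar s x)) (fun a => q (gname s a))
        (fun a => map (ren r q) (gargs s a))) M.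
Proof.
  revert s r q; induction M as [x|M IH|M IHM N IHN|b M IH]; intros s r q; simpl.
  - easy.
  - f_equal. rewrite IH. apply gs_ext; simpl; auto.
    + intros [|x]; simpl; auto. unfold lift_var. now rewrite !ren_ren.
    + intros a. rewrite !map_map. apply map_ext; intros N.
      unfold lift_var. now rewrite !ren_ren.
  - f_equal; auto.
  - rewrite ren_apps, IH.
    assert (E : forall a, map (ren r (up_ren q)) (up_args (gargs s) a) =
                up_args (fun a => map (ren r q) (gargs s a)) a).
    { intros [|a]; simpl; auto. rewrite !map_map. apply map_ext; intros N.
      unfold lift_name. now rewrite !ren_ren. }
    f_equal; [now destruct b|]. f_equal; [|apply E].
    apply gs_ext; simpl; auto.
    + intros x. unfold lift_name. now rewrite !ren_ren.
    + now intros [|a].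
Qed.

Lemma lift_name_gs (M : term) (s : gsub) :
  gs (up_mu s) (lift_name M) = lift_name (gs s M).
Proof.
  unfold lift_name. rewrite ren_comp_gs, gs_ren. now apply gs_ext.
Qed.

Lemma lift_var_gs (M : term) (s : gsub) :
  gs (up_lam s) (lift_var M) = lift_var (gs s M).
Proof.
  unfold lift_var. rewrite ren_comp_gs, gs_ren. now apply gs_ext.
Qed.

(** Lifting commutes with composition; in this form it rewrites the abstraction case of [gs_gs]. *)
Lemma up_mu_comp (t s : gsub) (M : term) (b : nat) :
  gmu (gcomp (up_mu t) (up_mu s)) b M = gs (gcomp t s) (Mu b M).
Proof.
  apply gmu_ext; simpl.
  - intros x. apply lift_name_gs.
  - now intros [|a].
  - intros [|a]; simpl; auto. rewrite map_app, !map_map. f_equal.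
    apply map_ext; intros N. apply lift_name_gs.
Qed.

Lemma gs_gs (M : term) (t s : gsub) : gs t (gs s M) = gs (gcomp t s) M.
Proof.
  revert t s; induction M as [x|M IH|M IHM N IHN|b M IH]; intros t s.
  - easy.
  - simpl; f_equal. rewrite IH. apply gs_ext; simpl; auto.
    + intros [|x]; simpl; auto. apply lift_var_gs.
    + intros a. rewrite map_app, !map_map. f_equal.
      apply map_ext; intros N. apply lift_var_gs.
  - simpl; f_equal; auto.
  - rewrite <- up_mu_comp. unfold gmu. rewrite <- IH. cbn [gs].
    now rewrite gs_apps, <- apps_app.
Qed.

Lemma gmu_gmu (M : term) (t s : gsub) (b : nat) :
  gmu t (gname s b) (apps (gs s M) (gargs s b)) = gmu (gcomp t s) b M.
Proof.
  unfold gmu. now rewrite gs_apps, gs_gs, <- apps_app.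
Qed.

Lemma gs_gmu (M : term) (t s : gsub) (b : nat) :
  gs t (gmu s b M) = gmu (gcomp (up_mu t) s) b M.
Proof. apply (gmu_gmu M (up_mu t) s b). Qed.

(** * The substitutions of the rules as instances of [gs] *)

Definition sbeta (N : term) : gsub :=
  GSub (fun x => match x with 0 => N | S y => Var y end) (fun a => a) (fun _ => []).

Definition sargs (l : list term) : gsub :=
  GSub Var (fun a => a) (fun a => match a with 0 => l | S _ => [] end).

Definition sinst (b : nat) : gsub := GSub Var (name_inst b) (fun _ => []).

Lemma subst_gs (M : term) (s : nat -> term) :
  subst s M = gs (GSub s (fun a => a) (fun _ => [])) M.
Proof.
  revert s; induction M as [x|M IH|M IHM N IHN|b M IH]; intros s; simpl;
    f_equal; auto.
  - now destruct b.
  - rewrite IH. replace (up_args (fun _ => []) b) with (@nil term)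
      by now destruct b. simpl.
    apply gs_ext; simpl; auto; now intros [|a].
Qed.

(** [gname] is the identity because the fresh name reuses the index of the replaced one. *)
Lemma ssubst_gs (M N : term) (a : nat) :
  ssubst a N M =
  gs (GSub Var (fun b => b) (fun b => if b =? a then [N] else [])) M.
Proof.
  revert N a; induction M as [x|M IH|M IHM Q IHQ|b M IH]; intros N a; simpl;
    f_equal; auto.
  - rewrite IH. apply gs_ext; simpl; auto.
    + now intros [|x].
    + intros c. now destruct (c =? a).
  - now destruct b.
  - assert (E : forall c, (if c =? S a then [lift_name N] else []) =
        up_args (fun b => if b =? a then [N] else []) c).
    { intros [|c]; simpl; auto. now destruct (c =? a). }
    rewrite <- E. unfold push_arg. rewrite IH, (gs_ext M _ (up_mu
      (GSub Var (fun b => b) (fun b => if b =? a then [N] else [])))); simpl; auto.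
    + now destruct (b =? S a).
    + now intros [|c].
Qed.

Lemma subst0_gs (N M : term) : subst0 N M = gs (sbeta N) M.
Proof. apply subst_gs. Qed.

Lemma push_arg_gmu (b : nat) (N M : term) :
  Mu b (push_arg 0 N b (ssubst 0 N M)) = gmu (sargs [N]) b M.
Proof.
  unfold push_arg, gmu. rewrite ssubst_gs. simpl. f_equal.
  replace (gs (sargs [N]) M) with
    (gs (GSub Var (fun b => b) (fun b => if b =? 0 then [N] else [])) M).
  - now destruct b.
  - apply gs_ext; simpl; auto. now intros [|c].
Qed.

Lemma name_subst0_gmu (b a : nat) (M : term) :
  Mu (name_inst b a) (name_subst0 b M) = gmu (sinst b) a M.
Proof. unfold gmu, name_subst0. simpl. now rewrite ren_gs. Qed.

(** * Free names under renaming and substitution *)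

Lemma fn_ren (M : term) (r q : nat -> nat) (a : nat) :
  fn a (ren r q M) <-> exists b, fn b M /\ a = q b.
Proof.
  revert r q a; induction M as [x|M IH|M IHM N IHN|b M IH]; intros r q a; simpl.
  - firstorder.
  - apply IH.
  - rewrite IHM, IHN. firstorder.
  - rewrite IH. split.
    + intros [E|(c & Hc & E)].
      * destruct b as [|b]; simpl in E; [discriminate|].
        injection E as E. eauto.
      * destruct c as [|c]; simpl in E; [discriminate|].
        injection E as E. eauto.
    + intros (c & [->| Hc] & ->); [now left|]. right. now exists (S c).
Qed.

Lemma fn_lift_name (M : term) (a : nat) : fn (S a) (lift_name M) <-> fn a M.
Proof.
  unfold lift_name. rewrite fn_ren. split.
  - now intros (b & Hb & [= ->]).
  - eauto.
Qed.

Lemma fn_0_lift_name (M : term) : ~ fn 0 (lift_name M).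
Proof. unfold lift_name. rewrite fn_ren. now intros (b & _ & E). Qed.

Lemma fn_lift_var (M : term) (a : nat) : fn a (lift_var M) <-> fn a M.
Proof.
  unfold lift_var. rewrite fn_ren. split; [|eauto]. now intros (b & Hb & ->).
Qed.

Lemma fn_apps (l : list term) (M : term) (a : nat) :
  fn a (apps M l) <-> fn a M \/ exists N, In N l /\ fn a N.
Proof.
  revert M; induction l as [|P l IH]; intros M; simpl.
  - firstorder.
  - rewrite IH. simpl. split.
    + intros [[H|H]|(N & HN & H)]; eauto.
    + intros [H|(N & [<-|HN] & H)]; eauto.
Qed.

Definition fn_image (s : gsub) (a b : nat) : Prop :=
  a = gname s b \/ exists N, In N (gargs s b) /\ fn a N.

Lemma fn_image_up_mu (s : gsub) (a b : nat) :
  fn_image (up_mu s) (S a) b -> exists c, b = S c /\ fn_image s a c.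
Proof.
  destruct b as [|c]; simpl.
  - intros [E|(N & [] & _)]; discriminate E.
  - intros [E|(N & HN & Ha)]; exists c; split; auto.
    + left. now injection E.
    + right. simpl in HN. apply in_map_iff in HN as (P & <- & HP).
      exists P. now rewrite <- fn_lift_name.
Qed.

(** An upper bound only: every [gvar s x] counts, whether or not [x] occurs in [M]. It suffices to
    show that reduction creates no free name. *)
Lemma fn_gs (M : term) (s : gsub) (a : nat) :
  fn a (gs s M) ->
  (exists x, fn a (gvar s x)) \/ exists b, fn b M /\ fn_image s a b.
Proof.
  revert s a; induction M as [x|M IH|M IHM N IHN|b M IH]; intros s a; simpl.
  - eauto.
  - intros H. apply IH in H as [[[|x] H]|(b & Hb & H)]; simpl in H.
    + easy.
    + left. exists x. now rewrite <- fn_lift_var.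
    + right. exists b. split; auto. destruct H as [H|(P & HP & H)]; [now left|].
      simpl in HP. apply in_map_iff in HP as (Q & <- & HQ).
      right. exists Q. now rewrite <- fn_lift_var.
  - intros [H|H]; [apply IHM in H|apply IHN in H]; firstorder.
  - rewrite fn_apps. intros H.
    assert (H' : fn (S a) (gs (up_mu s) M) \/ fn_image (up_mu s) (S a) b).
    { destruct H as [H|[H|H]]; auto; right; [now left|now right]. }
    destruct H' as [H'|H'].
    + apply IH in H' as [[x H']|(c & Hc & H')].
      * left. exists x. now rewrite <- fn_lift_name.
      * apply fn_image_up_mu in H' as (d & -> & H'). eauto.
    + apply fn_image_up_mu in H' as (d & -> & H'). eauto.
Qed.

Lemma fn_dec (a : nat) (M : term) : {fn a M} + {~ fn a M}.
Proof.
  revert a; induction M as [x|M IH|M IHM N IHN|b M IH]; intros a; simpl; auto.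
  - destruct (IHM a), (IHN a); tauto.
  - destruct (Nat.eq_dec b (S a)), (IH (S a)); tauto.
Defined.

(** * One-step reduction in terms of [gs] and lifting *)

Lemma lift_name_pred (M : term) :
  ~ fn 0 M -> lift_name (ren (fun x => x) pred M) = M.
Proof.
  intros H. unfold lift_name. rewrite ren_ren, ren_gs. apply gs_id; simpl; auto.
  intros [|a] Ha; easy.
Qed.

Lemma ren_pred_lift_name (M : term) :
  ren (fun x => x) pred (lift_name M) = M.
Proof. unfold lift_name. rewrite ren_ren, ren_gs. now apply gs_id. Qed.

Lemma sinst_lift_name (b : nat) (M : term) : gs (sinst b) (lift_name M) = M.
Proof. unfold lift_name. rewrite gs_ren. now apply gs_id. Qed.

Lemma sargs_lift_name (l : list term) (M : term) :
  gs (sargs l) (lift_name M) = lift_name M.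
Proof. unfold lift_name. now rewrite gs_ren, ren_gs. Qed.

Lemma sbeta_lift_var (N M : term) : gs (sbeta N) (lift_var M) = M.
Proof. unfold lift_var. rewrite gs_ren. now apply gs_id. Qed.

Lemma step_beta_gs (M N : term) : step (App (Lam M) N) (gs (sbeta N) M).
Proof. rewrite <- subst0_gs. constructor. Qed.

Lemma step_mu_gs (b : nat) (M N : term) :
  step (App (Mu b M) N) (gmu (sargs [lift_name N]) b M).
Proof. rewrite <- push_arg_gmu. constructor. Qed.

Lemma step_rename_gs (b a : nat) (M : term) :
  step (Mu b (Mu a M)) (gmu (sinst b) a M).
Proof. rewrite <- name_subst0_gmu. constructor. Qed.

Lemma step_erase_lift (M : term) : step (Mu 0 (lift_name M)) M.
Proof.
  rewrite <- (ren_pred_lift_name M) at 2. constructor. apply fn_0_lift_name.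
Qed.

(** Induction on [step] with contracta written by [gs] and [gmu], and with non-occurrence of the
    erased name expressed by [lift_name], so that the composition lemmas apply directly. *)
Lemma step_gs_ind (P : term -> term -> Prop) :
  (forall M N, P (App (Lam M) N) (gs (sbeta N) M)) ->
  (forall b M N, P (App (Mu b M) N) (gmu (sargs [lift_name N]) b M)) ->
  (forall b a M, P (Mu b (Mu a M)) (gmu (sinst b) a M)) ->
  (forall M, P (Mu 0 (lift_name M)) M) ->
  (forall M M', step M M' -> P M M' -> P (Lam M) (Lam M')) ->
  (forall M M' N, step M M' -> P M M' -> P (App M N) (App M' N)) ->
  (forall M N N', step N N' -> P N N' -> P (App M N) (App M N')) ->
  (forall b M M', step M M' -> P M M' -> P (Mu b M) (Mu b M')) ->
  forall M N, step M N -> P M N.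
Proof.
  intros Hbeta Hmu Hren Her Hl Hal Har HM M N H.
  induction H as [M N|b M N|b a M|M Hf| | | | ]; auto.
  - rewrite subst0_gs. apply Hbeta.
  - rewrite push_arg_gmu. apply Hmu.
  - rewrite name_subst0_gmu. apply Hren.
  - rewrite <- (lift_name_pred M Hf) at 1. apply Her.
Qed.

Lemma step_Mu_inv (b : nat) (M X : term) :
  step (Mu b M) X ->
  (exists M', X = Mu b M' /\ step M M') \/
  (exists a R, M = Mu a R /\ X = gmu (sinst b) a R) \/
  (b = 0 /\ M = lift_name X).
Proof.
  intros H; inversion H; subst.
  - right; left. rewrite name_subst0_gmu. eauto.
  - right; right. now rewrite lift_name_pred.
  - left. eauto.
Qed.

(** Used to see that a reduct of a lifted term is again lifted. *)
Lemma fn_step (M M' : term) (a : nat) : step M M' -> fn a M' -> fn a M.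
Proof.
  intros H; revert a. induction H using step_gs_ind; intros c; simpl; auto.
  - intros H. apply fn_gs in H as [[[|x] H]|(b & Hb & [H|(Q & [] & _)])];
      simpl in H; subst; auto. easy.
  - unfold gmu. simpl. rewrite fn_apps.
    assert (E : forall d Q, In Q (gargs (sargs [lift_name N]) d) ->
              fn (S c) Q -> fn c N).
    { intros [|d] Q; simpl; [|easy]. intros [<-|[]]. apply fn_lift_name. }
    intros [H|[H|(Q & HQ & H)]]; [auto| |right; now apply (E b Q)].
    apply fn_gs in H as [[x H]|(d & Hd & [H|(Q & HQ & H)])]; simpl in *; subst; eauto.
    easy.
  - intros [H|H].
    + destruct a; simpl in *; auto.
    + simpl in H. apply fn_gs in H as [[x H]|(d & Hd & [H|(Q & [] & H)])];
        [destruct H|]. simpl in H. destruct d; simpl in *; subst; auto.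
  - intros H. right. now apply fn_lift_name.
  - intuition.
  - intuition.
  - intuition.
Qed.

(** * Many-step reduction as a congruence *)

Lemma steps_refl M : steps M M.
Proof. apply rt_refl. Qed.

Lemma steps_step M N : step M N -> steps M N.
Proof. apply rt_step. Qed.

Lemma steps_trans M N P : steps M N -> steps N P -> steps M P.
Proof. apply rt_trans. Qed.

Lemma steps_map (f : term -> term) :
  (forall M N, step M N -> steps (f M) (f N)) ->
  forall M N, steps M N -> steps (f M) (f N).
Proof.
  intros Hf M N H; induction H; [auto|apply rt_refl|eapply rt_trans; eauto].
Qed.

Lemma steps_Lam M M' : steps M M' -> steps (Lam M) (Lam M').
Proof. apply steps_map with (f := Lam). intros; now apply rt_step, step_lam. Qed.

Lemma steps_Mu b M M' : steps M M' -> steps (Mu b M) (Mu b M').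
Proof. apply steps_map with (f := Mu b). intros; now apply rt_step, step_Mu. Qed.

Lemma steps_App M M' N N' :
  steps M M' -> steps N N' -> steps (App M N) (App M' N').
Proof.
  intros HM HN. apply steps_trans with (App M' N).
  - apply steps_map with (f := fun M => App M N); auto.
    intros; now apply rt_step, step_appl.
  - apply steps_map with (f := App M'); auto.
    intros; now apply rt_step, step_appr.
Qed.

Lemma steps_apps M M' l l' :
  steps M M' -> Forall2 steps l l' -> steps (apps M l) (apps M' l').
Proof.
  intros HM Hl; revert M M' HM.
  induction Hl; intros M M' HM; simpl; auto. apply IHHl. now apply steps_App.
Qed.

#[local] Hint Resolve steps_refl steps_step steps_Lam steps_Mu steps_App : core.

Lemma Forall2_steps_refl l : Forall2 steps l l.
Proof. induction l; auto. Qed.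
#[local] Hint Resolve Forall2_steps_refl : core.

(** * Contraction operators and the map [bul] *)

Definition apply (P Q : term) : term :=
  match P with
  | Lam R => gs (sbeta Q) R
  | Mu b R => gmu (sargs [lift_name Q]) b R
  | _ => App P Q
  end.

Definition applys (P : term) (l : list term) : term := fold_left apply l P.

(** At most one contraction: when [P] is itself a [Mu], erasing and renaming give
    the same term, so [mu] does not test for erasure there. *)
Definition mu (b : nat) (P : term) : term :=
  match P with
  | Mu a R => gmu (sinst b) a R
  | _ =>
      if b =? 0 then
        if fn_dec 0 P then Mu b P else ren (fun x => x) pred P
      else Mu b P
  end.

Fixpoint bul (M : term) : term :=
  match M with
  | Var x => Var x
  | Lam M => Lam (bul M)
  | App M N => apply (bul M) (bul N)
  | Mu b M => mu b (bul M)
  end.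

Lemma apply_gmu (s : gsub) (b : nat) (M Q : term) :
  apply (gmu s b M) Q = gmu (gcomp (sargs [lift_name Q]) s) b M.
Proof. apply gmu_gmu. Qed.

Lemma mu_gmu (s : gsub) (a b : nat) (M : term) :
  mu b (gmu s a M) = gmu (gcomp (sinst b) s) a M.
Proof. apply gmu_gmu. Qed.

(** Pushing arguments one by one equals pushing the whole list: those already attached are lifted,
    so the bound name does not occur in them and later pushes leave them unchanged. *)
Lemma applys_Mu (l : list term) (b : nat) (M : term) :
  applys (Mu b M) l = gmu (sargs (map lift_name l)) b M.
Proof.
  revert b M; induction l as [|N l IH]; intros b M; simpl.
  - unfold gmu. simpl. rewrite gs_id; simpl; auto.
    + now destruct b.
    + now intros [|a].
  - unfold gmu at 1. rewrite IH, gmu_gmu. apply gmu_ext; simpl; auto.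
    intros [|a]; simpl; auto. now rewrite sargs_lift_name.
Qed.

Lemma apply_ren (P Q : term) (r q : nat -> nat) :
  apply (ren r q P) (ren r q Q) = ren r q (apply P Q).
Proof.
  destruct P as [x|P|P1 P2|b P]; simpl; auto.
  - rewrite gs_ren, ren_comp_gs. apply gs_ext; simpl; auto. now intros [|x].
  - unfold gmu. simpl. rewrite ren_apps, gs_ren, ren_comp_gs.
    assert (E : lift_name (ren r q Q) = ren r (up_ren q) (lift_name Q))
      by (unfold lift_name; now rewrite !ren_ren).
    rewrite E. f_equal. f_equal; [|now destruct b].
    apply gs_ext; simpl; auto. now intros [|a].
Qed.

Lemma mu_not_Mu (b : nat) (P : term) :
  (forall a R, P <> Mu a R) ->
  mu b P = if b =? 0 then
             if fn_dec 0 P then Mu b P else ren (fun x => x) pred P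
           else Mu b P.
Proof. intros H. destruct P; auto. now destruct (H b0 P). Qed.

(** The critical pair of erasing and renaming is trivial: if [P] is itself a [Mu], renaming the
    inner bound name to 0 undoes the lifting under the inner binder. *)
Lemma mu_lift_name (P : term) : mu 0 (lift_name P) = P.
Proof.
  assert (H : (exists a R, P = Mu a R) \/ forall a R, lift_name P <> Mu a R)
    by (destruct P; eauto; now right).
  destruct H as [(a & R & ->)|H].
  - simpl. unfold gmu. simpl. f_equal; [now destruct a|].
    rewrite gs_ren. apply gs_id; simpl; auto. now intros [|c].
  - rewrite mu_not_Mu by assumption. simpl.
    destruct (fn_dec 0 (lift_name P)) as [Hf|_].
    + now apply fn_0_lift_name in Hf.
    + apply ren_pred_lift_name.
Qed.

Lemma mu_cases (b : nat) (P : term) :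
  (exists a R, P = Mu a R) \/
  (b = 0 /\ exists R, P = lift_name R) \/
  (mu b P = Mu b P /\ (forall a R, P <> Mu a R) /\ (b = 0 -> fn 0 P)).
Proof.
  assert (H : (exists a R, P = Mu a R) \/ forall a R, P <> Mu a R)
    by (destruct P; eauto; now right).
  destruct H as [H|H]; auto. right. rewrite mu_not_Mu by assumption.
  destruct b as [|b]; simpl.
  - destruct (fn_dec 0 P) as [Hf|Hf]; auto.
    left. split; auto. eexists. symmetry. now apply lift_name_pred.
  - right. repeat split; auto. easy.
Qed.

Lemma mu_ren (b : nat) (P : term) (r q : nat -> nat) :
  mu (up_ren q b) (ren r (up_ren q) P) = ren r q (mu b P).
Proof.
  destruct (mu_cases b P) as [(a & R & ->)|[(-> & R & ->)|(-> & HM & Hf)]].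
  - simpl. unfold gmu; simpl. rewrite gs_ren, ren_comp_gs. f_equal.
    + now destruct a.
    + apply gs_ext; simpl; auto. now intros [|c].
  - rewrite mu_lift_name. simpl.
    rewrite <- (mu_lift_name (ren r q R)). f_equal.
    unfold lift_name. now rewrite !ren_ren.
  - destruct (mu_cases (up_ren q b) (ren r (up_ren q) P))
      as [(a & R & E)|[(E & R & E')|(-> & _)]].
    + destruct P; try discriminate E. edestruct HM; reflexivity.
    (* [up_ren q] maps only 0 to 0, so [b] is 0 and name 0 is free in [P]. It is then free in the
       renamed term, which cannot be lifted. *)
    + destruct b as [|b]; [|discriminate E].
      destruct (fn_0_lift_name R). rewrite <- E'. apply fn_ren.
      exists 0. auto.
    + reflexivity.
Qed.

Lemma bul_ren (M : term) (r q : nat -> nat) : bul (ren r q M) = ren r q (bul M).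
Proof.
  revert r q; induction M as [x|M IH|M IHM N IHN|b M IH]; intros r q; simpl.
  - easy.
  - now rewrite IH.
  - now rewrite IHM, IHN, apply_ren.
  - now rewrite IH, mu_ren.
Qed.

(** * Soundness of [apply] and [mu], and reduction under substitution *)

Lemma steps_apply (P Q : term) : steps (App P Q) (apply P Q).
Proof.
  destruct P; simpl; auto; apply steps_step; [apply step_beta_gs|apply step_mu_gs].
Qed.

Lemma steps_mu (b : nat) (P : term) : steps (Mu b P) (mu b P).
Proof.
  destruct (mu_cases b P) as [(a & R & ->)|[(-> & R & ->)|(-> & _)]]; auto.
  - apply steps_step, step_rename_gs.
  - rewrite mu_lift_name. apply steps_step, step_erase_lift.
Qed.

Lemma steps_applys (P : term) (l : list term) : steps (apps P l) (applys P l).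
Proof.
  revert P; induction l as [|N l IH]; intros P; simpl; auto.
  eapply steps_trans; [|apply IH]. apply steps_apps; auto. apply steps_apply.
Qed.

(** On the left, the inner abstraction absorbs the arguments of the outer name before the renaming;
    on the right, renaming comes first. Either way the inner bound name becomes [gname s b] and
    receives exactly [gargs s b]. *)
Lemma rename_comp (s : gsub) (b a : nat) (M : term) :
  gmu (gcomp (sinst (gname s b))
        (gcomp (sargs (map lift_name (gargs s b))) (up_mu s))) a M =
  gmu (gcomp s (sinst b)) a M.
Proof.
  apply gmu_ext; simpl.
  - intros x. now rewrite sargs_lift_name, sinst_lift_name.
  - now intros [|c].
  - intros [|c]; simpl.
    + rewrite app_nil_r, map_map, (map_ext _ (fun N => N)); [apply map_id|].
      apply sinst_lift_name.
    + rewrite !app_nil_r, !map_map, (map_ext _ (fun N => N)); [apply map_id|].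
      intros N. now rewrite sargs_lift_name, sinst_lift_name.
Qed.

Lemma mu_applys_Mu (s : gsub) (b a : nat) (M : term) :
  mu (gname s b) (applys (gs s (Mu a M)) (gargs s b)) = gmu (gcomp s (sinst b)) a M.
Proof.
  rewrite <- rename_comp, <- gmu_gmu. cbn [gs]. now rewrite applys_Mu, gmu_gmu.
Qed.

(** Nested abstractions: the arguments attached to the outer name must be
    absorbed by the inner abstraction before the renaming can take place. *)
Lemma gmu_rename (s : gsub) (b a : nat) (M : term) :
  steps (gmu s b (Mu a M)) (gmu (gcomp s (sinst b)) a M).
Proof.
  rewrite <- mu_applys_Mu. eapply steps_trans; [|apply steps_mu].
  unfold gmu. apply steps_Mu. apply steps_applys.
Qed.

Lemma sbeta_comp (s : gsub) (N M : term) :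
  gs s (gs (sbeta N) M) = gs (sbeta (gs s N)) (gs (up_lam s) M).
Proof.
  rewrite !gs_gs. apply gs_ext; simpl; auto.
  - intros [|x]; simpl; auto. now rewrite sbeta_lift_var.
  - intros a. rewrite app_nil_r, map_map, (map_ext _ (fun P => P)).
    + symmetry; apply map_id.
    + apply sbeta_lift_var.
Qed.

(** The right side is the contractum of [App (gs s (Mu b M)) (gs s N)], so structural contraction
    commutes with substitution. *)
Lemma sargs_comp (s : gsub) (N M : term) (b : nat) :
  gs s (gmu (sargs [lift_name N]) b M) =
  gmu (sargs [lift_name (gs s N)]) (gname (up_mu s) b)
    (apps (gs (up_mu s) M) (gargs (up_mu s) b)).
Proof.
  rewrite gs_gmu, gmu_gmu. apply gmu_ext; simpl; auto.
  - intros x. now rewrite sargs_lift_name.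
  - intros [|a]; simpl.
    + now rewrite lift_name_gs.
    + rewrite app_nil_r, map_map. apply map_ext; intros P.
      now rewrite sargs_lift_name.
Qed.

(** Each rule is mapped to an instance of itself, except renaming: arguments attached to the outer
    name separate the two abstractions and have to be absorbed first, possibly in several steps. *)
Lemma step_gs (M M' : term) (s : gsub) :
  step M M' -> steps (gs s M) (gs s M').
Proof.
  intros H; revert s; induction H using step_gs_ind; intros s; try (simpl; auto; fail).
  - rewrite sbeta_comp. apply steps_step, step_beta_gs.
  - rewrite sargs_comp. apply steps_step, step_mu_gs.
  - rewrite gs_gmu. apply (gmu_rename (up_mu s)).
  - simpl. rewrite lift_name_gs. apply steps_step, step_erase_lift.
  - cbn [gs]. apply steps_Mu, steps_apps; auto.
Qed.

Lemma steps_gs (M M' : term) (s : gsub) :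
  steps M M' -> steps (gs s M) (gs s M').
Proof. apply steps_map with (f := gs s). intros; now apply step_gs. Qed.

Lemma steps_gmu (s : gsub) (b : nat) (M M' : term) :
  steps M M' -> steps (gmu s b M) (gmu s b M').
Proof. intros H. apply steps_Mu, steps_apps; auto. now apply steps_gs. Qed.

Lemma steps_ren (M M' : term) (r q : nat -> nat) :
  steps M M' -> steps (ren r q M) (ren r q M').
Proof. rewrite !ren_gs. apply steps_gs. Qed.

Lemma Forall2_steps_ren (r q : nat -> nat) (l l' : list term) :
  Forall2 steps l l' -> Forall2 steps (map (ren r q) l) (map (ren r q) l').
Proof. induction 1; simpl; constructor; auto. now apply steps_ren. Qed.

Definition gsteps (s t : gsub) : Prop :=
  (forall x, steps (gvar s x) (gvar t x)) /\
  (forall a, gname s a = gname t a) /\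
  (forall a, Forall2 steps (gargs s a) (gargs t a)).

Lemma gsteps_up_lam (s t : gsub) : gsteps s t -> gsteps (up_lam s) (up_lam t).
Proof.
  intros (Hv & Hn & Ha). repeat split; simpl; auto.
  - intros [|x]; simpl; auto. now apply steps_ren.
  - intros a. now apply Forall2_steps_ren.
Qed.

Lemma gsteps_up_mu (s t : gsub) : gsteps s t -> gsteps (up_mu s) (up_mu t).
Proof.
  intros (Hv & Hn & Ha). repeat split; simpl; auto.
  - intros x. now apply steps_ren.
  - intros [|a]; simpl; auto.
  - intros [|a]; simpl; auto. now apply Forall2_steps_ren.
Qed.

Lemma gs_gsteps (M : term) (s t : gsub) : gsteps s t -> steps (gs s M) (gs t M).
Proof.
  revert s t; induction M as [x|M IH|M IHM N IHN|b M IH]; intros s t H.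
  - apply H.
  - simpl. now apply steps_Lam, IH, gsteps_up_lam.
  - simpl. auto.
  - cbn [gs]. apply gsteps_up_mu in H. destruct H as (Hv & Hn & Ha).
    rewrite Hn. apply steps_Mu, steps_apps; auto. now apply IH.
Qed.

Lemma gmu_gsteps (b : nat) (M : term) (s t : gsub) :
  gsteps s t -> steps (gmu s b M) (gmu t b M).
Proof.
  intros H. unfold gmu. pose proof (gs_gsteps M s t H).
  destruct H as (Hv & -> & Ha). apply steps_Mu, steps_apps; auto.
Qed.

(** * Monotonicity of [apply] and [mu] *)

Lemma apply_lift_name (P Q : term) :
  apply (lift_name P) (lift_name Q) = lift_name (apply P Q).
Proof. apply apply_ren. Qed.

Lemma step_lift_name_inv (P P' : term) :
  step (lift_name P) P' -> exists R, P' = lift_name R /\ steps P R.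
Proof.
  intros H. exists (ren (fun x => x) pred P'). split.
  - symmetry. apply lift_name_pred. intros Hf.
    apply (fn_0_lift_name P). now apply (fn_step _ P').
  - rewrite <- (ren_pred_lift_name P). now apply steps_ren, steps_step.
Qed.

Lemma apply_mono (P P' Q Q' : term) :
  steps P P' -> steps Q Q' -> steps (apply P Q) (apply P' Q').
Proof.
  intros HP HQ. apply steps_trans with (apply P Q').
  - destruct P as [x|R|P1 P2|b R]; simpl; auto.
    + apply gs_gsteps. repeat split; simpl; auto. intros [|x]; auto.
    + apply gmu_gsteps. repeat split; simpl; auto. intros [|x]; auto.
      constructor; auto. now apply steps_ren.
  - revert HP. apply steps_map with (f := fun P => apply P Q').
    clear. intros P P' H. destruct P as [x|R|P1 P2|b R].
    + inversion H.
    + inversion H; subst. simpl. now apply step_gs.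
    (* The step may turn the application into an abstraction; [steps_apply] contracts the redex so
       created. *)
    + eapply steps_trans; [|apply steps_apply]. simpl. auto.
    + apply step_Mu_inv in H as [(R' & -> & H)|[(a & S & -> & ->)|[-> ->]]].
      * simpl. now apply steps_gmu, steps_step.
      * rewrite apply_gmu. apply (gmu_rename (sargs [lift_name Q'])).
      (* The step erased the abstraction. Pushing the argument into it only applies its lifted body
         to the lifted argument, so erasing is still possible. *)
      * simpl. unfold gmu. simpl. rewrite sargs_lift_name.
        change (App (lift_name P') (lift_name Q')) with (lift_name (App P' Q')).
        eapply steps_trans; [apply steps_step, step_erase_lift|].
        apply steps_apply.
Qed.

Lemma applys_mono (P P' : term) (l l' : list term) :
  steps P P' -> Forall2 steps l l' -> steps (applys P l) (applys P' l').
Proof.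
  intros HP Hl; revert P P' HP.
  induction Hl; intros P P' HP; simpl; auto. apply IHHl. now apply apply_mono.
Qed.

(** The critical pairs of renaming with an inner renaming or erasing close: contracting the inner
    abstraction first gives [mu] of the renamed body. If the inner one stays, only the outer
    renaming takes place. *)
Lemma mu_mu (b a : nat) (R : term) :
  mu b (mu a R) = gmu (sinst b) a R \/
  mu b (mu a R) = mu (name_inst b a) (gs (sinst b) R).
Proof.
  destruct (mu_cases a R) as [(c & S & ->)|[(-> & S & ->)|(-> & _)]]; auto.
  - right. simpl mu at 2. rewrite mu_gmu. symmetry.
    apply (mu_applys_Mu (sinst b) a c).
  - right. now rewrite mu_lift_name, sinst_lift_name.
Qed.

Lemma mu_mono (b : nat) (P P' : term) :
  steps P P' -> steps (mu b P) (mu b P').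
Proof.
  apply steps_map with (f := mu b). clear. intros P P' H.
  destruct (mu_cases b P) as [(a & R & ->)|[(-> & R & ->)|(-> & _)]].
  - apply step_Mu_inv in H as [(R' & -> & H)|[(c & S & -> & ->)|[-> ->]]].
    + simpl. now apply steps_gmu, steps_step.
    + rewrite mu_gmu. apply (gmu_rename (sinst b)).
    + simpl. unfold gmu. simpl. rewrite sinst_lift_name. apply steps_mu.
  - apply step_lift_name_inv in H as (R' & -> & H). now rewrite !mu_lift_name.
  - eapply steps_trans; [|apply steps_mu]. auto.
Qed.

(** * The Z property of [bul] *)

Lemma steps_bul (M : term) : steps M (bul M).
Proof.
  induction M as [x|M IH|M IHM N IHN|b M IH]; simpl; auto.
  - eapply steps_trans; [|apply steps_apply]. auto.
  - eapply steps_trans; [|apply steps_mu]. auto.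
Qed.

(** Not an equality: [s] may put an abstraction in place of a head variable, creating a redex that
    only the right side contracts. *)
Lemma gs_apply (s : gsub) (P Q : term) :
  steps (gs s (apply P Q)) (apply (gs s P) (gs s Q)).
Proof.
  destruct P as [x|P|P1 P2|b P].
  - apply steps_apply.
  - simpl. rewrite sbeta_comp. auto.
  - apply steps_apply.
  - simpl apply at 1. rewrite sargs_comp. apply steps_refl.
Qed.

Lemma gs_mu (s : gsub) (b : nat) (P : term) :
  steps (gs s (mu b P))
    (mu (gname (up_mu s) b) (applys (gs (up_mu s) P) (gargs (up_mu s) b))).
Proof.
  destruct (mu_cases b P) as [(a & R & ->)|[(-> & R & ->)|(-> & _)]].
  - rewrite mu_applys_Mu. simpl mu. rewrite gs_gmu. auto.
  - rewrite mu_lift_name, lift_name_gs. simpl. now rewrite mu_lift_name.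
  - eapply steps_trans; [|apply steps_mu]. cbn [gs].
    apply steps_Mu, steps_applys.
Qed.

Definition bul_gsub (s : gsub) : gsub :=
  GSub (fun x => bul (gvar s x)) (gname s) (fun a => map bul (gargs s a)).

Lemma bul_apps (M : term) (l : list term) :
  bul (apps M l) = applys (bul M) (map bul l).
Proof. revert M; induction l as [|N l IH]; intros M; simpl; auto. Qed.

(** Taking [bul] after the substitution also contracts the redexes that the substitution creates. *)
Lemma gs_bul (M : term) (s : gsub) :
  steps (gs (bul_gsub s) (bul M)) (bul (gs s M)).
Proof.
  revert s; induction M as [x|M IH|M IHM N IHN|b M IH]; intros s.
  - apply steps_refl.
  - simpl. apply steps_Lam. eapply steps_trans; [|apply IH].
    apply gs_gsteps. repeat split; simpl; auto.
    + intros [|x]; simpl; auto. unfold lift_var. now rewrite bul_ren.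
    + intros a. rewrite !map_map, (map_ext _ (fun N => bul (lift_var N))); auto.
      intros N. unfold lift_var. now rewrite bul_ren.
  - simpl. eapply steps_trans; [apply gs_apply|]. now apply apply_mono.
  - simpl bul. rewrite bul_apps.
    eapply steps_trans; [apply gs_mu|]. apply mu_mono.
    assert (E : forall a, gargs (up_mu (bul_gsub s)) a =
                  map bul (gargs (up_mu s) a)).
    { intros [|a]; simpl; auto. rewrite !map_map. apply map_ext.
      intros N. unfold lift_name. now rewrite bul_ren. }
    simpl in E. simpl gargs. rewrite E. apply applys_mono; auto.
    eapply steps_trans; [|apply IH].
    apply gs_gsteps. repeat split; simpl; auto.
    + intros x. unfold lift_name. now rewrite bul_ren.
    + intros a. rewrite E. auto.
Qed.

(** The contractum of a beta or structural redex is [apply] of its parts, that of a renaming redex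
    is [mu] of its parts; each part reduces to its [bul], and both operators are monotone. *)
Lemma step_to_bul (M N : term) : step M N -> steps N (bul M).
Proof.
  intros H; induction H using step_gs_ind; simpl bul.
  - apply (apply_mono (Lam M) (Lam (bul M)) N); auto using steps_bul.
  - apply (apply_mono (Mu b M) (mu b (bul M)) N); [|apply steps_bul].
    apply (steps_bul (Mu b M)).
  - eapply steps_trans; [apply (mu_mono b (Mu a M) (Mu a (bul M)))|].
    + apply steps_Mu, steps_bul.
    + destruct (mu_mu b a (bul M)) as [-> | ->]; simpl; auto. apply steps_mu.
  - unfold lift_name. rewrite bul_ren.
    change (steps M (mu 0 (lift_name (bul M)))). rewrite mu_lift_name.
    apply steps_bul.
  - auto.
  - eapply steps_trans; [|apply steps_apply]. auto using steps_bul.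
  - eapply steps_trans; [|apply steps_apply]. auto using steps_bul.
  - eapply steps_trans; [|apply steps_mu]. auto.
Qed.

Lemma bul_step (M N : term) : step M N -> steps (bul M) (bul N).
Proof.
  intros H; induction H using step_gs_ind; simpl bul.
  - eapply steps_trans; [|apply gs_bul].
    apply gs_gsteps. repeat split; simpl; auto. intros [|x]; auto.
  - rewrite bul_apps.
    (* The middle term is [bul] of the contractum with the substitution moved outside [bul];
       [gs_bul] then moves it back inside. *)
    eapply steps_trans with (mu b (applys (gs (sargs [lift_name (bul N)]) (bul M))
      (gargs (sargs [lift_name (bul N)]) b))).
    + destruct (mu_cases b (bul M)) as [(a & R & ->)|[(-> & R & ->)|(-> & _)]].
      * change b with (gname (sargs [lift_name (bul N)]) b) at 2.
        rewrite mu_applys_Mu. simpl mu.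
        rewrite apply_gmu. auto.
      * rewrite mu_lift_name, sargs_lift_name. simpl.
        rewrite apply_lift_name, mu_lift_name. auto.
      * simpl. eapply steps_trans; [|apply steps_mu].
        apply steps_Mu, steps_applys.
    + apply mu_mono.
      assert (E : lift_name (bul N) = bul (lift_name N))
        by (unfold lift_name; now rewrite bul_ren).
      rewrite E. apply applys_mono.
      * eapply steps_trans; [|apply gs_bul]. apply gs_gsteps.
        repeat split; simpl; auto. intros [|a]; simpl; auto.
      * destruct b; simpl; auto.
  - destruct (mu_mu b a (bul M)) as [-> | ->].
    + eapply steps_trans; [|apply steps_mu].
      unfold gmu. simpl. apply steps_Mu. apply (gs_bul M (sinst b)).
    + apply mu_mono, (gs_bul M (sinst b)).
  - unfold lift_name. rewrite bul_ren.
    change (steps (mu 0 (lift_name (bul M))) (bul M)). rewrite mu_lift_name. auto.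
  - auto.
  - apply apply_mono; auto.
  - apply apply_mono; auto.
  - apply mu_mono; auto.
Qed.

Lemma bul_steps (M N : term) : steps M N -> steps (bul M) (bul N).
Proof. apply steps_map with (f := bul). exact bul_step. Qed.

(** * Confluence and the Church-Rosser property *)

Lemma semi_confluent (M N P : term) :
  step M N -> steps M P -> exists Q, steps N Q /\ steps P Q.
Proof.
  intros HN HP. apply clos_rt_rtn1 in HP. destruct HP as [|P P' H HP].
  - eauto.
  (* [P] is now the last term before the end [P'] of the reduction. The two sides join by
     [P' ->> bul P] and [N ->> bul M ->> bul P]. *)
  - exists (bul P). split; [|now apply step_to_bul].
    apply steps_trans with (bul M); [now apply step_to_bul|].
    apply bul_steps. now apply clos_rtn1_rt.
Qed.

Lemma confluent (M N P : term) :
  steps M N -> steps M P -> exists Q, steps N Q /\ steps P Q.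
Proof.
  intros HN; revert P. apply clos_rt_rt1n in HN.
  induction HN as [|M M' N H HN IH]; intros P HP.
  - eauto.
  - destruct (semi_confluent M M' P H HP) as (Q & H1 & H2).
    destruct (IH Q H1) as (R & H3 & H4). exists R. split; auto.
    now apply steps_trans with Q.
Qed.

Lemma church_rosser (M N : term) :
  eq_betamu M N -> exists P, steps M P /\ steps N P.
Proof.
  induction 1 as [M N H|M|M N _ (P & H1 & H2)|M N P _ (Q & H1 & H2) _ (R & H3 & H4)
    |M M' _ (P & H1 & H2)|M M' N N' _ (P & H1 & H2) _ (Q & H3 & H4)
    |b M M' _ (P & H1 & H2)]; eauto 6.
  destruct (confluent N Q R H2 H3) as (T & H5 & H6).
  exists T; split; eapply steps_trans; eauto.
Qed.

(** * Weak approximants persist under reduction *)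

Lemma pfn_ple (A B : pterm) (a : nat) : ple A B -> pfn a A -> pfn a B.
Proof. intros H; revert a; induction H; simpl; firstorder. Qed.

Lemma pfn_embed (M : term) (a : nat) : pfn a (embed M) <-> fn a M.
Proof. revert a; induction M; intros a; simpl; firstorder. Qed.

(** The transitivity rule defeats plain inversion, so the shape of [B] is recovered by induction. *)
Lemma ple_inv (A B : pterm) :
  ple A B ->
  match A with
  | PBot => True
  | PVar x => B = PVar x
  | PLam A0 => exists B0, B = PLam B0 /\ ple A0 B0
  | PApp A0 A1 => exists B0 B1, B = PApp B0 B1 /\ ple A0 B0 /\ ple A1 B1
  | PMu b A0 => exists B0, B = PMu b B0 /\ ple A0 B0
  end.
Proof.
  induction 1 as [A|A|A B C _ IH1 _ IH2|A A' H|A A' B B' H1 _ H2|b A A' H]; eauto 6.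
  - destruct A; eauto 6 using ple_refl.
  - destruct A; auto.
    + now subst.
    + destruct IH1 as (B0 & -> & H1), IH2 as (C0 & -> & H2).
      eauto using ple_trans.
    + destruct IH1 as (B0 & B1 & -> & H1 & H1'), IH2 as (C0 & C1 & -> & H2 & H2').
      eauto 8 using ple_trans.
    + destruct IH1 as (B0 & -> & H1), IH2 as (C0 & -> & H2).
      eauto using ple_trans.
Qed.

Definition stable (A : pterm) : Prop :=
  forall M M', ple A (embed M) -> step M M' -> ple A (embed M').

(** Excludes beta and structural redexes along the spine of a term above a head variable with
    arguments. *)
Lemma ple_head_var (x : nat) (As : list pterm) (M : term) :
  ple (fold_left PApp As (PVar x)) (embed M) ->
  (forall R, M <> Lam R) /\ (forall b R, M <> Mu b R).
Proof.
  destruct As as [|A As _] using rev_ind; simpl.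
  - intros H%ple_inv. now destruct M.
  - rewrite fold_left_app. simpl. intros (B0 & B1 & H & _)%ple_inv.
    now destruct M.
Qed.

Lemma stable_head_var (x : nat) (As : list pterm) :
  (forall A, In A As -> stable A) -> stable (fold_left PApp As (PVar x)).
Proof.
  induction As as [|A As IH] using rev_ind; simpl; intros HA M M' HM Hs.
  - apply ple_inv in HM. destruct M; try discriminate HM. inversion Hs.
  - rewrite fold_left_app in HM |- *. simpl in *.
    apply ple_inv in HM as (B0 & B1 & E & H0 & H1).
    destruct M as [|?|P Q|? ?]; try discriminate E.
    injection E as <- <-. destruct (ple_head_var _ _ _ H0) as [HL HM].
    inversion Hs; subst.
    + edestruct HL; reflexivity.
    + edestruct HM; reflexivity.
    + apply ple_app; auto. apply (IH) with P; auto.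
      intros B HB. apply HA, in_or_app; auto.
    + apply ple_app; auto. apply (HA A) with Q; auto.
      apply in_or_app; simpl; auto.
Qed.

Lemma stable_weak_approximant (A : pterm) : weak_approximant A -> stable A.
Proof.
  induction 1 as [|A _ IH|x As _ IH|b A _ IH Hb HM HB]; intros M M' Hle Hs.
  - apply ple_bot.
  - apply ple_inv in Hle as (B & E & H). destruct M; try discriminate E.
    injection E as <-. inversion Hs; subst. apply ple_lam. eauto.
  - eapply stable_head_var; eauto.
  - apply ple_inv in Hle as (B & E & H).
    destruct M as [| | |c R]; try discriminate E. injection E as -> <-.
    apply step_Mu_inv in Hs as [(R' & -> & Hs)|[(d & S & -> & _)|[-> ->]]].
    + apply ple_mu. eauto.
    (* Renaming requires a nested abstraction, but only [PBot] or a [PMu] lies below one, and [A] is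
       neither. *)
    + apply ple_inv in H. destruct A; try easy.
      * now destruct H as (? & ? & _).
      * now destruct H as (? & ? & ? & _).
      * now destruct (HM b0 A).
    (* Erasing requires [b = 0]; then name 0 occurs in [A], hence in every term above it, which
       cannot be lifted. *)
    + destruct Hb as [Hb|Hb]; [easy|]. apply (pfn_ple _ _ _ H) in Hb.
      now apply pfn_embed, fn_0_lift_name in Hb.
Qed.

Lemma ple_steps (A : pterm) (M M' : term) :
  weak_approximant A -> ple A (embed M) -> steps M M' -> ple A (embed M').
Proof.
  intros HA H Hs; induction Hs; auto. now apply (stable_weak_approximant A HA x).
Qed.

Lemma approximants_incl (M N : term) (A : pterm) :
  eq_betamu M N -> approximants M A -> approximants N A.
Proof.
  intros (P & HM & HN)%church_rosser (HA & Q & HQ & Hle). split; auto.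
  (* [R] is a reduct of [N] through [P], and it stays above [A] as a reduct of [Q]. *)
  destruct (confluent M Q P HQ HM) as (R & HQR & HPR).
  exists R. split; [now apply steps_trans with P|]. now apply ple_steps with Q.
Qed.

Theorem theorem6p5 (M N : term) (H : eq_betamu M N) : equiv_wA M N.
Proof.
  intros A. split; apply approximants_incl; auto using eqbm_sym.
Qed.
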